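(* Let $\mathcal{W}=\{(W_i,\omega_i)\}_{i\in I}$ be a fusion Riesz basis for $\mathcal{H}$ and let $\mathcal{V}=\{(V_i,\upsilon_i)\}_{i\in I}$ be a fusion frame for $\mathcal{H}$ that is a dual of $\mathcal{W}$ and has excess $e(\mathcal{V})=1$. Then $\mathcal{V}$ is not operator-scalable.
   Context: $\mathcal{H}$ is a separable Hilbert space, $B(\mathcal{H})$ the bounded operators on $\mathcal{H}$, $I$ a countable index set, $\pi_W$ the orthogonal projection onto a closed subspace $W$. A family of weights is a family of strictly positive numbers. For closed subspaces $W_i$ and weights $\omega_i$, $\mathcal{W}=\{(W_i,\omega_i)\}_{i\in I}$ is a fusion frame for $\mathcal{H}$ if there are $0<A\le B<\infty$ with $A\|f\|^2\le\sum_{i\in I}\omega_i^2\|\pi_{W_i}f\|^2\le B\|f\|^2$ for all $f\in\mathcal{H}$; it is Parseval if $A=B=1$ can be taken. It is a fusion Bessel sequence if only the upper bound is required. Let $\sum_{i\in I}\bigoplus W_i=\{\{f_i\}_{i\in I}: f_i\in W_i,\ \sum_i\|f_i\|^2<\infty\}$. The synthesis operator is $T_{\mathcal{W}}:\sum_{i\in I}\bigoplus W_i\to\mathcal{H}$, $T_{\mathcal{W}}(\{f_i\})=\sum_i\omega_if_i$, and the fusion frame operator is $S_{\mathcal{W}}=T_{\mathcal{W}}T_{\mathcal{W}}^*$, i.e. $S_{\mathcal{W}}f=\sum_i\omega_i^2\pi_{W_i}f$, which is invertible for a fusion frame. $\mathcal{W}$ is a fusion Riesz basis if the closed linear span of $\bigcup_iW_i$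 is $\mathcal{H}$ and there are $C,D>0$ such that $C\sum_{j\in J}\|f_j\|^2\le\|\sum_{j\in J}\omega_jf_j\|^2\le D\sum_{j\in J}\|f_j\|^2$ for every finite $J\subset I$ and all $f_j\in W_j$. A fusion Bessel sequence $\mathcal{V}=\{(V_i,\upsilon_i)\}_{i\in I}$ is a dual of the fusion frame $\mathcal{W}$ if $T_{\mathcal{V}}\varphi_{\mathcal{VW}}T_{\mathcal{W}}^*=I_{\mathcal{H}}$, where $\varphi_{\mathcal{VW}}:\sum_{i\in I}\bigoplus W_i\to\sum_{i\in I}\bigoplus V_i$ is $\varphi_{\mathcal{VW}}(\{f_i\})=\{\pi_{V_i}S_{\mathcal{W}}^{-1}f_i\}_{i\in I}$. The excess of a fusion frame $\mathcal{V}$ is $e(\mathcal{V})=\dim N(T_{\mathcal{V}})$, $N$ denoting the null space. A fusion frame $\{(V_i,\upsilon_i)\}_{i\in I}$ is operator-scalable if there exist an invertible $U\in B(\mathcal{H})$ and a family of weights $\{\gamma_i\}_{i\in I}$ such that $\{(UV_i,\upsilon_i\gamma_i)\}_{i\in I}$ is a Parseval fusion frame for $\mathcal{H}$.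
   Formalization: The formal theorem also assumes that every subspace W_i of the fusion Riesz basis is nonzero; otherwise the claim fails, e.g. H one-dimensional, W=(H,0), V=(H,H), all weights 1, which has excess 1 and is scaled to Parseval by U=I, γ_i=1/√2. *)

(* Defs.v *)
From HB Require Import structures.
From mathcomp Require Import all_boot all_order all_algebra finmap.
From mathcomp Require Import sesquilinear complex.
From mathcomp Require Import all_classical all_reals all_analysis.
From mathcomp.analysis.showcase Require Import summability.

Set Implicit Arguments.
Unset Strict Implicit.
Unset Printing Implicit Defensive.

Import Order.TTheory GRing.Theory Num.Theory.
Import numFieldNormedType.Exports.

Local Open Scope classical_set_scope.
Local Open Scope ring_scope.

(* The scalar field of a Hilbert space is R or R[i], uniformly in [k]. *)
Inductive scalar_kind := RealScalars | ComplexScalars.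

Definition scalar_field (R : realType) (k : scalar_kind) : numFieldType :=
  match k with
  | RealScalars => R
  | ComplexScalars => R[i]
  end.

Definition scalar_conj (R : realType) (k : scalar_kind) :
    scalar_field R k -> scalar_field R k :=
  match k with
  | RealScalars => idfun
  | ComplexScalars => conjc
  end.

Section Spaces.
Variable K : numFieldType.

Definition separable_space (T : topologicalType) : Prop :=
  exists2 D : set T, countable D & dense D.

Definition linear_subspace (E : lmodType K) (W : set E) : Prop :=
  W 0 /\ forall (a : K) x y, W x -> W y -> W (a *: x + y).

Definition linear_span (E : lmodType K) (A : set E) : set E :=
  smallest (@linear_subspace E) A.

Definition closed_subspace (H : normedModType K) (W : set H) : Prop :=
  linear_subspace W /\ closed W.

Definition has_dim (E : lmodType K) (N : set E) (n : nat) : Prop :=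
  exists2 b : 'I_n -> E,
    forall c : 'I_n -> K, \sum_i c i *: b i = 0 -> forall i, c i = 0 &
    N = range (fun c : 'I_n -> K => \sum_i c i *: b i).

Definition invertible_operator (H : normedModType K) (U : {linear H -> H}) :
    Prop :=
  continuous U /\
  exists U' : {linear H -> H}, [/\ continuous U', cancel U U' & cancel U' U].

End Spaces.

(* Norms, weights and bounds take values in the scalar field K; over R[i],
   [0 < a] and [0 <= a] force [a] to be real.  Sums over the index set are
   limits of finite partial sums along the filter [totally]. *)
Section FusionFrames.
Variables (K : numFieldType) (conj : K -> K) (H : completeNormedModType K).
Variables (ip : {dot H for conj}) (I : countType).
Implicit Types (W V : I -> set H) (w v : I -> K) (f g : H) (h : I -> H).

Definition orth_proj (W : set H) (f : H) : H :=
  xget 0 [set p | W p /\ forall g, W g -> ip (f - p) g = 0].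

Definition weighted_subspaces W w : Prop :=
  (forall i, closed_subspace (W i)) /\ (forall i, 0 < w i).

Definition fusion_sum W w f (s : K) : Prop :=
  partial_sum (fun i => w i ^+ 2 * `|orth_proj (W i) f| ^+ 2) @ totally --> s.

Definition fusion_frame_bounds W w (A B : K) : Prop :=
  forall f, exists2 s, fusion_sum W w f s &
    A * `|f| ^+ 2 <= s /\ s <= B * `|f| ^+ 2.

Definition fusion_frame W w : Prop :=
  weighted_subspaces W w /\
  exists A B : K, [/\ 0 < A, A <= B & fusion_frame_bounds W w A B].

Definition parseval_fusion_frame W w : Prop :=
  weighted_subspaces W w /\ fusion_frame_bounds W w 1 1.

Definition fusion_bessel W w : Prop :=
  weighted_subspaces W w /\
  exists2 B : K, 0 < B &
    forall f, exists2 s, fusion_sum W w f s & s <= B * `|f| ^+ 2.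

Definition l2_sum W : set (I -> H) :=
  [set h | (forall i, W i (h i)) /\
           cvg (partial_sum (fun i => `|h i| ^+ 2) @ totally)].

Definition l2_ip (h h' : I -> H) : K :=
  lim (partial_sum (fun i => ip (h i) (h' i)) @ totally).

Definition synthesis w h : H := sum (fun i => w i *: h i).

(* The Hilbert space adjoint of [synthesis w : l2_sum W -> H]. *)
Definition synthesis_adj W w f : I -> H :=
  xget 0 [set h | l2_sum W h /\
                  forall h', l2_sum W h' -> l2_ip h' h = ip (synthesis w h') f].

Definition frame_operator W w f : H := synthesis w (synthesis_adj W w f).

Definition frame_operator_inv W w : H -> H :=
  'pinv_(fun=> 0) setT (frame_operator W w).

Definition phi_op W w V h : I -> H :=
  fun i => orth_proj (V i) (frame_operator_inv W w (h i)).

Definition fusion_riesz_basis W w : Prop :=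
  [/\ weighted_subspaces W w,
      closure (linear_span (\bigcup_i W i)) = setT &
      exists C D : K, [/\ 0 < C, 0 < D &
        forall (J : {fset I}) h, (forall j, j \in J -> W j (h j)) ->
          C * partial_sum (fun j => `|h j| ^+ 2) J
            <= `|partial_sum (fun j => w j *: h j) J| ^+ 2 /\
          `|partial_sum (fun j => w j *: h j) J| ^+ 2
            <= D * partial_sum (fun j => `|h j| ^+ 2) J]].

(* [V, v] is a dual of [W, w]. *)
Definition fusion_dual W w V v : Prop :=
  fusion_bessel V v /\
  forall f, synthesis v (phi_op W w V (synthesis_adj W w f)) = f.

Definition synthesis_kernel V v : set (I -> H) :=
  [set h | l2_sum V h /\ synthesis v h = 0].

Definition has_excess V v (n : nat) : Prop :=
  has_dim (synthesis_kernel V v) n.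

Definition operator_scalable V v : Prop :=
  exists (U : {linear H -> H}) (c : I -> K),
    [/\ invertible_operator U, forall i, 0 < c i &
        parseval_fusion_frame (fun i => U @` V i) (fun i => v i * c i)].

End FusionFrames.

(* Main.v *)
Require Import Defs.
From HB Require Import structures.
From mathcomp Require Import all_boot all_order all_algebra finmap.
From mathcomp Require Import sesquilinear complex ring.
From mathcomp Require Import all_classical all_reals all_analysis.
From mathcomp.analysis.showcase Require Import summability.

(** Why the theorem holds.  Write [X i] for the subspace of vectors orthogonal to
    every [W j] with [j != i]; for a fusion Riesz basis it is the image of [W i]
    under the inverse of the frame operator.  On [X i] the adjoint of the
    synthesis operator of [W] has a single nonzero component, so testing the
    duality identity on a vector [f] of [X i] gives
    [f = (v i / w i) *: orth_proj (V i) f].  Hence [X i] lies inside [V i], and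
    [v i = w i] because [X i] is nonzero
    ([biorthogonal_nontrivial], [dual_contains_biorthogonal]).

    Let [n] span the kernel of the synthesis operator of [V].  Suppose that an
    invertible [U] and weights [c] make [(U V i, c i)] a Parseval fusion frame, and
    let [P i] be the projection onto [U V i].  For [x] in [V j], the reconstruction
    formula [U x = \sum_i c i ^+ 2 *: P i (U x)], pulled back by [U^-1], exhibits
    the family [((c i ^+ 2 - (i == j)) / v i) *: U^-1 (P i (U x))] as a kernel
    element, hence as a multiple of [n] ([scaled_kernel_vector]).  Its [j]-th entry
    is [((c j ^+ 2 - 1) / v j) *: x].
    - If [c j ^+ 2 != 1], taking [x] nonzero in [X j] shows that [n j] is a multiple
      of [x], so [n j] lies in [X j].
    - If [c j ^+ 2 = 1], the Parseval identity on [U V j] is exhausted by its [j]-th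
      term, so [U V j] is orthogonal to all the other [U V i]; pairing
      [\sum_i v i *: U (n i) = 0] with [U (n j)] then gives [n j = 0].

    Thus [n i] is in [X i] for every [i].  Pairing [\sum_i v i *: n i = 0] with
    elements of [W j] shows that [n j] is orthogonal to [W j] as well, hence to all
    the [W i], hence zero: the kernel is trivial, whereas it has dimension one.

    The rest is the Hilbert space theory that this argument rests on: the
    projection theorem, unconditional summation, and the description of the adjoint
    of the synthesis operator. *)

Set Implicit Arguments.
Unset Strict Implicit.
Unset Printing Implicit Defensive.

Import Order.TTheory GRing.Theory Num.Theory.
Import numFieldNormedType.Exports.

Local Open Scope classical_set_scope.
Local Open Scope ring_scope.

#[local] Existing Instance totally_filter.



(** * Nonnegative scalars *)

Section Scalars.
Variables (R : realType) (k : scalar_kind).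
Notation K := (scalar_field R k).
Notation conj := (@scalar_conj R k).

(** Over complex scalars the order is partial, but all elements of [A] are
    nonnegative, hence real, and the supremum can be taken on real parts.  Together
    with [scalar_conj_ge0] this is where the real and complex cases are treated
    separately; everything below is uniform in [k]. *)
Lemma scalar_sup (A : set K) (B : K) :
    A !=set0 -> (forall x, A x -> 0 <= x /\ x <= B) ->
  exists2 s, (forall x, A x -> x <= s) &
             forall e, 0 < e -> exists2 x, A x & s - e < x.
Proof.
case: k A B => [|] /= A B [x0 Ax0] bA.
  have hsA : has_sup A.
    by split; [exists x0 | exists B; apply/ubP => x /bA[_]].
  exists (sup A); first by move=> x; apply: (sup_upper_bound hsA).
  move=> e e0.
  exact: sup_adherent.
pose A' : set R := [set complex.Re x | x in A].
have reA x : A x -> x = (complex.Re x)%:C%C.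
  by move=> /bA[+ _]; case: x => a b; rewrite lecE /= => /andP[/eqP-> _].
have hsA : has_sup A'.
  split; first by exists (complex.Re x0); exists x0.
  exists (complex.Re B) => _ [x /bA[_]] + <-; by rewrite lecE => /andP[].
exists (sup A')%:C%C => [x Ax|e].
  by rewrite (reA _ Ax) lecR; apply: sup_upper_bound => //; exists x.
rewrite ltcE /= => /andP[/eqP/= ime e0].
have [_ [x Ax <-] lx] := sup_adherent e0 hsA.
exists x => //; rewrite (reA _ Ax) ltcE /=.
by case: (e) ime lx => a b /= -> ->; rewrite subr0 eqxx.
Qed.

Lemma scalar_conj_ge0 (a : K) : 0 <= a -> conj a = a.
Proof.
case: k a => [a|[a b]] //=; rewrite lecE /= => /andP[/eqP-> _].
by rewrite oppr0.
Qed.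

End Scalars.

Lemma scalar_inf (R : realType) (k : scalar_kind) (A : set (scalar_field R k)) :
    A !=set0 -> (forall x, A x -> 0 <= x) ->
  exists2 d, (forall x, A x -> d <= x) &
             forall e, 0 < e -> exists2 x, A x & x < d + e.
Proof.
move=> [x0 Ax0] A0.
have [||s sub sad] := @scalar_sup R k [set x0 - x | x in [set x | A x /\ x <= x0]] x0.
- by exists (x0 - x0), x0.
- move=> _ [x [Ax xx0] <-]; rewrite subr_ge0; split => //.
  by rewrite gerBl A0.
exists (x0 - s) => [x Ax|e /sad[_ [x [Ax _] <-]]]; last first.
  move=> h; exists x => //; rewrite -subr_gt0; 
  have -> : x0 - s + e - x = x0 - x - (s - e) by ring.
  by rewrite subr_gt0.
have /orP[xx0|x0x] : (x <= x0) || (x0 <= x).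
  by apply: real_leVge; apply: ger0_real; apply: A0.
- by rewrite lerBlDr -lerBlDl; apply: sub; exists x.
- apply: le_trans x0x; rewrite gerBl -(subrr x0).
  by apply: sub; exists x0.
Qed.

(** * Unconditional sums *)

Section FiniteSums.
Variable I : choiceType.

Lemma partial_sumE (V : zmodType) (x : I -> V) (J : {fset I}) :
  partial_sum x J = \sum_(i <- J) x i.
Proof. by rewrite big_seq_fsetE. Qed.

Lemma partial_sum_split (V : zmodType) (x : I -> V) (J0 J : {fset I}) :
  (J0 `<=` J)%fset -> partial_sum x J = partial_sum x J0 + partial_sum x (J `\` J0)%fset.
Proof.
move=> J0J; rewrite !partial_sumE (big_fsetID _ (mem J0)) /=; congr (_ + _).
  apply: eq_fbigl => i; rewrite !inE andbC /=.
  by case: (boolP (i \in J0)) => //= /(fsubsetP J0J).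
by apply: eq_fbigl => i; rewrite !inE andbC.
Qed.

Lemma partial_sumB (V : zmodType) (x y : I -> V) (J : {fset I}) :
  partial_sum (fun i => x i - y i) J = partial_sum x J - partial_sum y J.
Proof. by rewrite !partial_sumE sumrB. Qed.

Lemma partial_sum_linear (K : pzRingType) (V : lmodType K) (V' : zmodType)
    (s : K -> V' -> V') (f : {linear V -> V' | s}) (x : I -> V) (J : {fset I}) :
  partial_sum (fun i => f (x i)) J = f (partial_sum x J).
Proof. by rewrite !partial_sumE linear_sum. Qed.

Lemma partial_sum_eq0 (V : zmodType) (x : I -> V) (J : {fset I}) (i : I) :
  (forall j, j != i -> x j = 0) -> i \in J -> partial_sum x J = x i.
Proof.
move=> x0 iJ; rewrite partial_sumE (big_fsetD1 i) //= big_seq big1 ?addr0 //.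
by move=> j; rewrite !inE => /andP[ji _]; exact: x0.
Qed.

Lemma partial_sum_ge0 (K : numDomainType) (a : I -> K) (J : {fset I}) :
  (forall i, 0 <= a i) -> 0 <= partial_sum a J.
Proof. by move=> a0; rewrite partial_sumE sumr_ge0. Qed.

Lemma near_totally (J0 : {fset I}) (P : {fset I} -> Prop) :
  (forall J, (J0 `<=` J)%fset -> P J) -> \forall J \near totally, P J.
Proof. by move=> h; exists J0. Qed.

Lemma totally_near (P : {fset I} -> Prop) :
  (\forall J \near totally, P J) -> exists J0 : {fset I}, forall J, (J0 `<=` J)%fset -> P J.
Proof. by case=> J0 _ h; exists J0 => J; exact: h. Qed.

End FiniteSums.

Section InfiniteSums.
Variables (K : numFieldType) (I : choiceType).

Lemma cvg_partial_sum1 (V : normedModType K) (x : I -> V) (i : I) :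
  (forall j, j != i -> x j = 0) -> partial_sum x @ totally --> x i.
Proof.
move=> x0; apply: cvg_near_cst; apply: (@near_totally _ [fset i]%fset) => J.
by rewrite fsub1set => iJ; exact: partial_sum_eq0.
Qed.

(** Nonnegativity is the closed condition [l = `|l|]; this form survives when the
    order is only partial. *)
Lemma cvg_ge0 (T : Type) (F : set_system T) (FF : ProperFilter F) (f : T -> K) (l : K) :
  f @ F --> l -> (\forall x \near F, 0 <= f x) -> 0 <= l.
Proof.
move=> fl f0; have nfl : (fun x => `|f x|) @ F --> `|l| by exact: cvg_norm.
suff -> : l = `|l| by [].
apply: (norm_cvg_unique fl); apply: cvg_trans nfl; apply: near_eq_cvg.
by near=> x; rewrite ger0_norm//; near: x.
Unshelve. all: end_near. Qed.

Lemma cvg_totally_le (a b : {fset I} -> K) (s t : K) (J0 : {fset I}) :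
    a @ totally --> s -> b @ totally --> t ->
  (forall J, (J0 `<=` J)%fset -> a J <= b J) -> s <= t.
Proof.
move=> cs ct ab; rewrite -subr_ge0.
apply: (@cvg_ge0 _ totally _ (fun J => b J - a J)); first exact: cvgB.
by apply: (@near_totally _ J0) => J /ab; rewrite subr_ge0.
Qed.

End InfiniteSums.
Section NonnegativeFamilies.
Variables (K : numFieldType) (I : choiceType) (a : I -> K).
Hypothesis a_ge0 : forall i, 0 <= a i.

Lemma partial_sum_mono (J0 J : {fset I}) :
  (J0 `<=` J)%fset -> partial_sum a J0 <= partial_sum a J.
Proof. by move=> JJ; rewrite (partial_sum_split _ JJ) lerDl partial_sum_ge0. Qed.

Lemma partial_sum_le_lim (s : K) (J : {fset I}) :
  partial_sum a @ totally --> s -> partial_sum a J <= s.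
Proof.
move=> cs; apply: (@cvg_totally_le _ _ (fun=> partial_sum a J) _ _ _ J _ cs).
  exact: cvg_cst.
by move=> J'; exact: partial_sum_mono.
Qed.

(** Cauchy criterion: applied to [J `\` J0], the domination bounds the increments
    of the partial sums of [x] by those of the convergent series [a]. *)
Lemma cvg_partial_sum_dominated (V : completeNormedModType K) (x : I -> V) (B s : K) :
    0 < B -> partial_sum a @ totally --> s ->
    (forall J, `|partial_sum x J| ^+ 2 <= B * partial_sum a J) ->
  cvg (partial_sum x @ totally).
Proof.
move=> B0 cs xa; apply: cauchy_cvg; apply: cauchy_exP => e e0.
have e'0 : 0 < e ^+ 2 / B by rewrite divr_gt0 ?exprn_gt0.
have /cvgrPdist_lt/(_ _ e'0)/totally_near[J0 hJ0] := cs.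
exists (partial_sum x J0); apply: (@near_totally _ J0) => J J0J.
rewrite -ball_normE /= distrC -(ltr_pXn2r (n:=2)) ?nnegrE ?(ltW e0)//.
rewrite (partial_sum_split _ J0J) addrAC subrr add0r.
apply: (le_lt_trans (xa _)); rewrite -[ltRHS](divfK (lt0r_neq0 B0)) mulrC ltr_pM2r//.
have -> : partial_sum a (J `\` J0)%fset = partial_sum a J - partial_sum a J0.
  by rewrite (partial_sum_split a J0J) addrAC subrr add0r.
apply: le_lt_trans (hJ0 J0 (fsubset_refl _)).
rewrite ger0_norm ?subr_ge0 ?partial_sum_le_lim//.
by rewrite lerD2r partial_sum_le_lim.
Qed.

End NonnegativeFamilies.

(** Partial sums of nonnegative terms increase with the index set, so they converge
    to their supremum. *)
Lemma cvg_partial_sum_bounded (R : realType) (k : scalar_kind) (I : choiceType)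
    (a : I -> scalar_field R k) (B : scalar_field R k) :
    (forall i, 0 <= a i) -> (forall J, partial_sum a J <= B) ->
  cvg (partial_sum a @ totally).
Proof.
move=> a0 aB.
have [||s sub sad] := @scalar_sup R k (range (partial_sum a)) B.
- by exists (partial_sum a fset0), fset0.
- by move=> _ [J _ <-]; rewrite partial_sum_ge0.
apply/cvg_ex; exists s; apply/cvgrPdist_lt => e /sad[_ [J0 _ <-] lJ0].
apply: (@near_totally _ J0) => J J0J.
rewrite ger0_norm ?subr_ge0; last by apply: sub; exists J.
rewrite ltrBlDr -ltrBlDl; apply: (lt_le_trans lJ0).
exact: partial_sum_mono.
Qed.

(** * Inner products and orthogonal projections *)

Section InnerProduct.
Variables (R : realType) (k : scalar_kind).
Notation K := (scalar_field R k).
Notation conj := (@scalar_conj R k).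
Variables (H : completeNormedModType K) (ip : {dot H for conj}).
Hypothesis normE : forall f : H, `|f| ^+ 2 = ip f f.

Lemma ipC x y : ip x y = conj (ip y x).
Proof. by rewrite hermitian_subproof expr0 mul1r. Qed.

Lemma ip_eq0C x y : ip x y = 0 -> ip y x = 0.
Proof. by rewrite [ip y x]ipC => ->; rewrite scalar_conj_ge0. Qed.

Lemma ipZl a x y : ip (a *: x) y = a * ip x y.
Proof. by rewrite linearZl_LR. Qed.

Lemma ipZr a x y : ip x (a *: y) = conj a * ip x y.
Proof. by rewrite linearZr. Qed.

Lemma norm2_gt0 (g : H) : g != 0 -> 0 < `|g| ^+ 2.
Proof. by move=> g0; rewrite exprn_gt0 ?normr_gt0. Qed.

Lemma norm2D x y : `|x + y| ^+ 2 = `|x| ^+ 2 + `|y| ^+ 2 + (ip x y + ip y x).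
Proof.
rewrite !normE linearDl !linearDr /=; ring.
Qed.

Lemma norm2B x y : `|x - y| ^+ 2 = `|x| ^+ 2 + `|y| ^+ 2 - (ip x y + ip y x).
Proof. by rewrite norm2D normrN linearNl linearNr -opprD. Qed.

Lemma pythagoras x y : ip x y = 0 -> `|x + y| ^+ 2 = `|x| ^+ 2 + `|y| ^+ 2.
Proof. by move=> xy; rewrite norm2D xy (ip_eq0C xy) !addr0. Qed.

(** Pythagoras along the line spanned by [g]; Cauchy-Schwarz and the variational
    step of the projection theorem are both read off from it. *)
Lemma norm2_line_decomposition x g : g != 0 ->
  `|x| ^+ 2 = `|x - (ip x g / `|g| ^+ 2) *: g| ^+ 2 + `|ip x g| ^+ 2 / `|g| ^+ 2.
Proof.
move=> g0; have n0 := lt0r_neq0 (norm2_gt0 g0).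
set a := _ / _; rewrite -[in LHS](subrK (a *: g) x) pythagoras; last first.
  by rewrite ipZr linearBl /= ipZl -normE /a divfK// subrr mulr0.
rewrite normrZ /a normrM normfV (ger0_norm (x := `|g| ^+ 2)) ?exprn_ge0//.
by congr (_ + _); rewrite !exprMn -mulrA; congr (_ * _); rewrite expr2 -mulrA mulVf// mulr1.
Qed.

Lemma cauchy_schwarz2 x y : `|ip x y| ^+ 2 <= `|x| ^+ 2 * `|y| ^+ 2.
Proof.
have [->|y0] := eqVneq y 0; first by rewrite linear0r !normr0 expr0n/= mulr0.
rewrite -ler_pdivrMr ?norm2_gt0// [leRHS](norm2_line_decomposition _ y0).
by rewrite lerDr exprn_ge0.
Qed.

Lemma cauchy_schwarz x y : `|ip x y| <= `|x| * `|y|.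
Proof.
by rewrite -(ler_pXn2r (n:=2)) ?nnegrE ?mulr_ge0// exprMn cauchy_schwarz2.
Qed.

Lemma cvg_ipl (T : Type) (F : set_system T) (FF : Filter F) (f : T -> H) (l g : H) :
  f @ F --> l -> (fun x => ip (f x) g) @ F --> ip l g.
Proof.
move=> fl; apply/cvgrPdist_lt => e e0.
have e'0 : 0 < e / (`|g| + 1) by rewrite divr_gt0 // ltr_wpDl.
move/cvgrPdist_lt/(_ _ e'0) : fl; apply: filterS => x lx.
rewrite -linearBl; apply: (le_lt_trans (cauchy_schwarz _ _)).
have g1 : 0 < `|g| + 1 by rewrite ltr_wpDl.
move: lx; rewrite ltr_pdivlMr//; apply: le_lt_trans.
by rewrite ler_wpM2l// lerDl.
Qed.

Lemma cvg_ip_sum (I : choiceType) (x : I -> H) (l g : H) :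
  partial_sum x @ totally --> l ->
  partial_sum (fun i => ip (x i) g) @ totally --> ip l g.
Proof.
move=> xl; apply: cvg_trans (cvg_ipl _ xl); apply: near_eq_cvg.
apply: (near_totally (J0 := fset0)) => J _; rewrite !partial_sumE.
by rewrite linear_sumlz.
Qed.

End InnerProduct.
Section Projections.
Variables (R : realType) (k : scalar_kind).
Notation K := (scalar_field R k).
Notation conj := (@scalar_conj R k).
Variables (H : completeNormedModType K) (ip : {dot H for conj}).
Hypothesis normE : forall f : H, `|f| ^+ 2 = ip f f.

Lemma parallelogram (x y : H) :
  `|x + y| ^+ 2 + `|x - y| ^+ 2 = 2 * (`|x| ^+ 2 + `|y| ^+ 2).
Proof. by rewrite (norm2D normE) (norm2B normE); ring. Qed.

(** The projection theorem in a form that spares closing up [L]: elements of [L]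
    nearly at minimal distance from [f] form a Cauchy filter by the parallelogram
    law, and its limit is the foot of the perpendicular. *)
Lemma projection_closure (L : set H) (f : H) : linear_subspace L ->
  exists2 p, closure L p & forall g, L g -> ip (f - p) g = 0.
Proof.
move=> [L0 LD].
have LZ a x : L x -> L (a *: x) by move=> Lx; rewrite -[_ *: _]addr0; apply: LD.
have [||d dlb dap] := @scalar_inf R k [set `|f - l| ^+ 2 | l in L].
- by exists (`|f - 0| ^+ 2), 0.
- by move=> _ [l _ <-]; rewrite exprn_ge0.
pose A e := [set l | L l /\ `|f - l| ^+ 2 < d + e].
(* The near-minimizers; the limit of this filter is the projection of [f]. *)
pose F := filter_from [set e : K | 0 < e] A.
have FF : ProperFilter F.
  apply: filter_from_proper; last first.
    by move=> e /dap[_ [l Ll <-] le]; exists l.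
  apply: filter_from_filter; first by exists 1; exact: ltr01.
  move=> e e' e0 e'0.
  have /orP[ee|ee] : (e <= e') || (e' <= e).
    by apply: real_leVge; apply: gtr0_real.
  - exists e => // l [Ll le]; split; split => //.
    by apply: lt_le_trans le _; rewrite lerD2l.
  - exists e' => // l [Ll le]; split; split => //.
    by apply: lt_le_trans le _; rewrite lerD2l.
have Fsmall e : 0 < e -> F (A e) by exists e.
have /cvg_ex[p Fp] : cvg F.
  apply: cauchy_cvg; apply: cauchy_exP => e e0.
  have e4 : 0 < e ^+ 2 / 4 by rewrite divr_gt0 ?exprn_gt0.
  have [_ [l Ll <-] le] := dap _ e4.
  exists l; exists (e ^+ 2 / 4) => // l' [Ll' le'].
  rewrite -ball_normE /= -(ltr_pXn2r (n:=2)) ?nnegrE ?(ltW e0)//.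
  have -> : l - l' = (f - l') - (f - l).
    by rewrite opprB [RHS]addrC subrKA.
  have /(congr1 (fun z => z - `|(f - l') + (f - l)| ^+ 2)) := parallelogram (f - l') (f - l).
  rewrite addrAC subrr add0r => ->.
  have : 4 * d <= `|(f - l') + (f - l)| ^+ 2.
    have -> : (f - l') + (f - l) = 2 *: (f - 2^-1 *: (l' + l)).
      rewrite scalerBr scalerA divff ?pnatr_eq0// scale1r scaler_nat mulr2n.
      by rewrite opprD addrACA.
    rewrite normrZ exprMn normr_nat -natrX ler_pM2l ?ltr0n//.
    apply: dlb; exists (2^-1 *: (l' + l)) => //; apply: LZ.
    by rewrite -[l']scale1r; apply: LD.
  rewrite -lerN2 => h; apply: (@le_lt_trans _ _ (2 * (`|f - l'| ^+ 2 + `|f - l| ^+ 2) - 4 * d)).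
    by rewrite lerD2l.
  have -> : e ^+ 2 = 2 * ((d + e ^+ 2 / 4) + (d + e ^+ 2 / 4)) - 4 * d by field.
  by rewrite ltrD2r ltr_pM2l ?ltr0n// ltrD.
exists p => [B Bp|g Lg].
  have FL : F L by exists 1; [exact: ltr01 | move=> l []].
  exact: (filter_ex (filterI FL (Fp _ Bp))).
have c1 : (fun l => ip (f - l) g) @ F --> ip (f - p) g.
  by apply: (cvg_ipl normE); apply: cvgB => //; exact: cvg_cst.
suff c2 : (fun l => ip (f - l) g) @ F --> (0 : K) by exact: (norm_cvg_unique c1 c2).
apply/cvgrPdist_lt => e e0.
have g1 : 0 < `|g| ^+ 2 + 1 by rewrite ltr_wpDl ?exprn_ge0.
have e'0 : 0 < e ^+ 2 / (`|g| ^+ 2 + 1) by rewrite divr_gt0 ?exprn_gt0.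
apply: filterS (Fsmall _ e'0) => l [Ll le].
rewrite sub0r normrN.
have [->|gn0] := eqVneq g 0; first by rewrite linear0r normr0.
have G := norm2_gt0 gn0.
rewrite -(ltr_pXn2r (n:=2)) ?nnegrE ?(ltW e0)//.
(* Moving [l] along [g] cannot bring it closer to [f] than the infimum [d], while
   [l] itself is within [e ^+ 2 / (`|g| ^+ 2 + 1)] of it. *)
have : `|ip (f - l) g| ^+ 2 / `|g| ^+ 2 < e ^+ 2 / (`|g| ^+ 2 + 1).
  rewrite -(ltrD2l d); apply: le_lt_trans le.
  rewrite [leRHS](norm2_line_decomposition normE _ gn0) lerD2r.
  apply: dlb; exists (l + (ip (f - l) g / `|g| ^+ 2) *: g); last by rewrite opprD addrA.
  by rewrite addrC; apply: LD.
rewrite ltr_pdivrMr// => h; apply: (lt_le_trans h).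
by rewrite mulrAC ler_pdivrMr// ler_wpM2l ?exprn_ge0 ?(ltW e0)// lerDl.
Qed.

Section OrthProj.
Variable W : set H.
Hypothesis Wc : closed_subspace W.

Lemma closed_subspace0 : W 0. Proof. by case: Wc => -[]. Qed.

Lemma closed_subspaceZ a x : W x -> W (a *: x).
Proof. by case: Wc => -[W0 WD] _ Wx; rewrite -[_ *: _]addr0; exact: WD. Qed.

Lemma closed_subspaceB x y : W x -> W y -> W (x - y).
Proof. by case: Wc => -[W0 WD] _ Wx Wy; rewrite addrC -scaleN1r; exact: WD. Qed.

Lemma orth_projP f : W (orth_proj ip W f) /\
  forall g, W g -> ip (f - orth_proj ip W f) g = 0.
Proof.
apply: (@xgetPex _ _ [set p | W p /\ forall g, W g -> ip (f - p) g = 0]).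
case: Wc => Wl Wcl; have [p clp hp] := projection_closure f Wl.
by exists p; split => //; rewrite ((closure_id W).1 Wcl).
Qed.

Lemma orth_proj_in f : W (orth_proj ip W f).
Proof. by case: (orth_projP f). Qed.

Lemma ip_orth_proj f g : W g -> ip (orth_proj ip W f) g = ip f g.
Proof.
move=> Wg; apply/eqP; rewrite eq_sym -subr_eq0 -linearBl; apply/eqP.
exact: (orth_projP f).2.
Qed.

Lemma orth_proj_unique f p :
  W p -> (forall g, W g -> ip p g = ip f g) -> orth_proj ip W f = p.
Proof.
move=> Wp hp; apply/eqP; rewrite -subr_eq0 -normr_eq0 -sqrf_eq0 normE.
have WB := closed_subspaceB (orth_proj_in f) Wp.
by rewrite linearBl /= ip_orth_proj// hp// subrr.
Qed.

Lemma orth_proj_id f : W f -> orth_proj ip W f = f.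
Proof. by move=> Wf; exact: orth_proj_unique. Qed.

Lemma orth_projB f g :
  orth_proj ip W (f - g) = orth_proj ip W f - orth_proj ip W g.
Proof.
apply: orth_proj_unique; first by apply: closed_subspaceB; exact: orth_proj_in.
by move=> h Wh; rewrite !linearBl /= !ip_orth_proj.
Qed.

Lemma orth_projZ a f : orth_proj ip W (a *: f) = a *: orth_proj ip W f.
Proof.
apply: orth_proj_unique; first by apply: closed_subspaceZ; exact: orth_proj_in.
by move=> h Wh; rewrite !ipZl ip_orth_proj.
Qed.

Lemma orth_proj_eq0 f : (forall g, W g -> ip f g = 0) -> orth_proj ip W f = 0.
Proof.
move=> fW; apply: orth_proj_unique; first exact: closed_subspace0.
by move=> g /fW ->; rewrite linear0l.
Qed.

Lemma orth_proj_eq0_ip f g : orth_proj ip W f = 0 -> W g -> ip f g = 0.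
Proof. by move=> pf Wg; rewrite -ip_orth_proj// pf linear0l. Qed.

Lemma orth_proj_sym f g : ip (orth_proj ip W f) g = ip f (orth_proj ip W g).
Proof.
rewrite ipC -(ip_orth_proj g (orth_proj_in f)) -ipC.
by rewrite ip_orth_proj//; exact: orth_proj_in.
Qed.

Lemma norm2_orth_proj f : ip (orth_proj ip W f) f = `|orth_proj ip W f| ^+ 2.
Proof. by rewrite normE (ip_orth_proj f (orth_proj_in f)) orth_proj_sym. Qed.

End OrthProj.
End Projections.

(** * Synthesis operators, their adjoints and frame operators *)

Section Synthesis.
Variables (R : realType) (k : scalar_kind).
Notation K := (scalar_field R k).
Notation conj := (@scalar_conj R k).
Variables (H : completeNormedModType K) (ip : {dot H for conj}).
Hypothesis normE : forall f : H, `|f| ^+ 2 = ip f f.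
Variables (I : countType).

Definition delta_fam (i : I) (x : H) : I -> H := fun j => if j == i then x else 0.

Lemma delta_fam_in (W : I -> set H) i x :
  (forall j, closed_subspace (W j)) -> W i x -> forall j, W j (delta_fam i x j).
Proof.
by move=> Wc Wx j; rewrite /delta_fam; case: eqP => [->//|_]; exact: closed_subspace0.
Qed.

Lemma lim_partial_sum (V : normedModType K) (x : I -> V) (l : V) :
  partial_sum x @ totally --> l -> lim (partial_sum x @ totally) = l.
Proof. by move=> /(cvg_lim (@norm_hausdorff _ V)). Qed.

Variables (W : I -> set H) (w : I -> K).
Hypothesis Ww : weighted_subspaces W w.

Let Wc i : closed_subspace (W i). Proof. by case: Ww => + _; exact. Qed.
Let w_gt0 i : 0 < w i. Proof. by case: Ww => _; exact. Qed.
Let w_neq0 i : w i != 0. Proof. exact: lt0r_neq0. Qed.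
Let conj_w i : conj (w i) = w i.
Proof. by rewrite scalar_conj_ge0// ltW. Qed.

(** The synthesis operator is bounded, with squared norm at most [D]; only finite
    sums enter, so that convergence of the infinite ones is a consequence
    ([cvg_synthesis]). *)
Definition synthesis_bound (D : K) : Prop :=
  forall (J : {fset I}) (h : I -> H), (forall j, W j (h j)) ->
    `|partial_sum (fun j => w j *: h j) J| ^+ 2 <= D * partial_sum (fun j => `|h j| ^+ 2) J.

Lemma delta_fam_l2 i x : W i x -> l2_sum W (delta_fam i x).
Proof.
move=> Wx; split; first exact: delta_fam_in.
apply/cvg_ex; exists (`|delta_fam i x i| ^+ 2).
apply: (@cvg_partial_sum1 K I K (fun j => `|delta_fam i x j| ^+ 2)) => j /negPf ji.
by rewrite /delta_fam ji normr0 expr0n.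
Qed.

Lemma cvg_synthesis_delta i (x : H) :
  partial_sum (fun j => w j *: delta_fam i x j) @ totally --> w i *: x.
Proof.
have {2}-> : x = delta_fam i x i by rewrite /delta_fam eqxx.
apply: (@cvg_partial_sum1 K I H (fun j => w j *: delta_fam i x j)) => j /negPf ji.
by rewrite /delta_fam ji scaler0.
Qed.

Lemma synthesis_delta i x : synthesis w (delta_fam i x) = w i *: x.
Proof. exact/lim_partial_sum/cvg_synthesis_delta. Qed.

Lemma ip_scale_in i x f : W i x ->
  ip x (w i *: orth_proj ip (W i) f) = ip (w i *: x) f.
Proof.
move=> Wx; rewrite ipZr conj_w ipZl -(orth_proj_sym normE (Wc i)).
by rewrite (orth_proj_id normE (Wc i) Wx).
Qed.

Lemma ip_weighted_proj f (J : {fset I}) :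
  ip (partial_sum (fun i => w i ^+ 2 *: orth_proj ip (W i) f) J) f =
  partial_sum (fun i => w i ^+ 2 * `|orth_proj ip (W i) f| ^+ 2) J.
Proof.
rewrite !partial_sumE linear_sumlz; apply: eq_bigr => i _ /=.
by rewrite ipZl (norm2_orth_proj normE (Wc i)).
Qed.

Lemma weighted_term_ge0 f i : 0 <= w i ^+ 2 * `|orth_proj ip (W i) f| ^+ 2.
Proof. by rewrite mulr_ge0 ?exprn_ge0// ltW. Qed.

Lemma norm2_weighted i (x : H) : `|w i *: x| ^+ 2 = w i ^+ 2 * `|x| ^+ 2.
Proof. by rewrite normrZ exprMn ger0_norm// ltW. Qed.

(** The synthesis operator is bounded because its adjoint is: for the finite sum [z],
    expand [`|z| ^+ 2] as a sum of inner products with [z] and apply Cauchy-Schwarz,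
    then the inequality of arithmetic and geometric means, termwise. *)
Lemma synthesis_bound_of_bessel (B : K) : 0 < B ->
    (forall (J : {fset I}) f,
      partial_sum (fun i => w i ^+ 2 * `|orth_proj ip (W i) f| ^+ 2) J <= B * `|f| ^+ 2) ->
  synthesis_bound B.
Proof.
move=> B0 hB J h Wh; set z := partial_sum _ J.
have zz : `|z| ^+ 2 <= partial_sum (fun i => `|h i| * (w i * `|orth_proj ip (W i) z|)) J.
  rewrite -[leLHS](ger0_norm (exprn_ge0 _ (normr_ge0 _))) normE {1}/z !partial_sumE linear_sumlz.
  apply: le_trans (ler_norm_sum _ _ _) _; apply: ler_sum => i _.
  rewrite /= -ip_scale_in//; apply: le_trans (cauchy_schwarz normE _ _) _.
  by rewrite normrZ gtr0_norm.
have zB := hB J z.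
(* From [2 * B * a * b <= B ^+ 2 * a ^+ 2 + b ^+ 2]; by [zB] the squares of the [b]
   add up to at most [B * `|z| ^+ 2], half of the left-hand side. *)
have ab : B * `|z| ^+ 2 + B * `|z| ^+ 2 <=
    B ^+ 2 * partial_sum (fun i => `|h i| ^+ 2) J + B * `|z| ^+ 2.
  apply: le_trans (lerD (lexx _) zB).
  apply: (@le_trans _ _ (partial_sum
    (fun i => (B + B) * (`|h i| * (w i * `|orth_proj ip (W i) z|))) J)).
    by rewrite -mulrDl !partial_sumE -mulr_sumr -partial_sumE ler_wpM2l ?addr_ge0 ?(ltW B0).
  rewrite !partial_sumE mulr_sumr -big_split /=; apply: ler_sum => i _.
  set a := `|h i|; set b := `|orth_proj _ _ _|.
  have : 0 <= (B * a - w i * b) ^+ 2.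
    apply: real_exprn_even_ge0 => //; apply: rpredB; apply: ger0_real.
      by rewrite mulr_ge0 ?normr_ge0// ltW.
    by rewrite mulr_ge0 ?normr_ge0// ltW.
  rewrite -subr_ge0.
  by have -> : B ^+ 2 * a ^+ 2 + w i ^+ 2 * b ^+ 2 - (B + B) * (a * (w i * b)) =
    (B * a - w i * b) ^+ 2 by ring.
move: ab; rewrite lerD2r expr2 -mulrA ler_pM2l//.
Qed.

Variable D : K.
Hypothesis D_gt0 : 0 < D.
Hypothesis Wbound : synthesis_bound D.

Lemma cvg_synthesis h : l2_sum W h ->
  partial_sum (fun i => w i *: h i) @ totally --> synthesis w h.
Proof.
move=> [Wh /cvg_ex[s hs]].
suff /cvg_ex[l hl] : cvg (partial_sum (fun i => w i *: h i) @ totally).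
  by rewrite /synthesis /sum (lim_partial_sum hl).
apply: (@cvg_partial_sum_dominated K I (fun i => `|h i| ^+ 2) _ H _ D s) => //.
by move=> J; exact: Wbound.
Qed.

(** Converse of [synthesis_bound_of_bessel]; it holds since [`|z - D *: f| ^+ 2 >= 0],
    where [z] is the partial sum of the frame operator at [f]. *)
Lemma bessel_of_synthesis_bound f (J : {fset I}) :
  partial_sum (fun i => w i ^+ 2 * `|orth_proj ip (W i) f| ^+ 2) J <= D * `|f| ^+ 2.
Proof.
set s := partial_sum _ J.
pose z := partial_sum (fun i => w i ^+ 2 *: orth_proj ip (W i) f) J.
have s0 : 0 <= s by apply: partial_sum_ge0 => i; exact: weighted_term_ge0.
have cD : conj D = D by rewrite scalar_conj_ge0// ltW.
have zf : ip z f = s by exact: ip_weighted_proj.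
have fz : ip f z = s by rewrite ipC zf scalar_conj_ge0.
have zz : `|z| ^+ 2 <= D * s.
  have Wp j : W j (w j *: orth_proj ip (W j) f).
    by apply: closed_subspaceZ => //; exact: orth_proj_in.
  apply: le_trans (le_trans (Wbound J Wp) _).
    rewrite /z !partial_sumE le_eqVlt; apply/orP; left; apply/eqP; congr (`|_| ^+ 2).
    by apply: eq_bigr => i _; rewrite scalerA -expr2.
  rewrite ler_pM2l// /s !partial_sumE ler_sum// => i _.
  by rewrite norm2_weighted.
have : 0 <= `|z - D *: f| ^+ 2 by rewrite exprn_ge0.
rewrite (norm2B normE) ipZr ipZl cD zf fz normrZ exprMn gtr0_norm// => h.
have {h} : 0 <= D * (D * `|f| ^+ 2 - s).
  apply: le_trans h _; rewrite -subr_le0.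
  have -> : `|z| ^+ 2 + D ^+ 2 * `|f| ^+ 2 - (D * s + D * s) - D * (D * `|f| ^+ 2 - s) =
    `|z| ^+ 2 - D * s by ring.
  by rewrite subr_le0.
by rewrite pmulr_rge0// subr_ge0.
Qed.

Lemma analysis_l2 f : l2_sum W (fun i => w i *: orth_proj ip (W i) f).
Proof.
split; first by move=> i; apply: closed_subspaceZ => //; exact: orth_proj_in.
apply: (@cvg_partial_sum_bounded R k I _ (D * `|f| ^+ 2)).
  by move=> i; rewrite exprn_ge0.
move=> J; apply: le_trans (bessel_of_synthesis_bound f J).
by rewrite !partial_sumE; apply: ler_sum => i _; rewrite norm2_weighted.
Qed.

(** The adjoint of the synthesis operator is the analysis operator.  Testing against
    families with one nonzero entry shows that the adjoint condition has no other
    square-summable solution. *)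
Lemma synthesis_adjE f :
  synthesis_adj ip W w f = fun i => w i *: orth_proj ip (W i) f.
Proof.
apply: xget_unique.
  split; first exact: analysis_l2.
  move=> h' h'2; rewrite /l2_ip; apply: lim_partial_sum.
  apply: cvg_trans (cvg_ip_sum normE (g := f) (cvg_synthesis h'2)).
  apply: near_eq_cvg; apply: (near_totally (J0 := fset0)) => J _.
  by rewrite !partial_sumE; apply: eq_bigr => i _; rewrite ip_scale_in//; case: h'2.
move=> y [[Wy _] hy]; apply/funext => i.
set p := w i *: _; have Wp : W i p.
  by apply: closed_subspaceZ => //; exact: orth_proj_in.
have Wd : W i (y i - p) by exact: closed_subspaceB.
have := hy _ (delta_fam_l2 Wd); rewrite synthesis_delta -ip_scale_in// -/p.
rewrite /l2_ip (lim_partial_sum (@cvg_partial_sum1 K I K _ i _)); last first.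
  by move=> j /negPf ji; rewrite /delta_fam ji linear0l.
rewrite /delta_fam eqxx => /eqP; rewrite -subr_eq0 -linearBr /= -normE.
by rewrite sqrf_eq0 normr_eq0 subr_eq0 => /eqP.
Qed.

(** With [S] the frame operator, the form [ip (S d) d] is the sum of the nonnegative terms
    [w i ^+ 2 * `|orth_proj ip (W i) d| ^+ 2]; if [d] is the difference of two points
    with the same image, each of them vanishes and [d] is orthogonal to all the [W i]. *)
Lemma frame_operator_inj :
    (forall g, (forall i x, W i x -> ip g x = 0) -> g = 0) ->
  injective (frame_operator ip W w).
Proof.
move=> total f g; rewrite /frame_operator !synthesis_adjE => fg.
apply/eqP; rewrite -subr_eq0; apply/eqP; apply: total => i x Wx.
apply: (orth_proj_eq0_ip normE (Wc i)) Wx.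
have c0 : partial_sum (fun i => w i ^+ 2 *: orth_proj ip (W i) (f - g)) @ totally --> (0 : H).
  rewrite -(subrr (synthesis w (fun i => w i *: orth_proj ip (W i) g))) -{1}fg.
  apply: cvg_trans (cvgB (cvg_synthesis (analysis_l2 f)) (cvg_synthesis (analysis_l2 g))).
  apply: near_eq_cvg; apply: (near_totally (J0 := fset0)) => J _.
  rewrite fctE -partial_sumB !partial_sumE; apply: eq_bigr => j _.
  by rewrite (orth_projB normE (Wc j)) -!scalerBr scalerA expr2.
have := cvg_ip_sum normE (g := f - g) c0; rewrite linear0l => c1.
have := @partial_sum_le_lim _ _ _ _ _ [fset i]%fset c1.
rewrite partial_sumE big_seq_fset1 ipZl (norm2_orth_proj normE (Wc i)) => h.
apply/eqP; rewrite -normr_eq0 -sqrf_eq0 eq_le exprn_ge0// andbT.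
rewrite -(pmulr_rle0 _ (exprn_gt0 2 (w_gt0 i))); apply: h => j.
by rewrite ipZl (norm2_orth_proj normE (Wc j)) weighted_term_ge0.
Qed.

End Synthesis.

(** * Fusion Riesz bases and their duals *)

Section Riesz.
Variables (R : realType) (k : scalar_kind).
Notation K := (scalar_field R k).
Notation conj := (@scalar_conj R k).
Variables (H : completeNormedModType K) (ip : {dot H for conj}).
Hypothesis normE : forall f : H, `|f| ^+ 2 = ip f f.
Variables (I : countType) (W : I -> set H) (w : I -> K).
Hypothesis rieszW : fusion_riesz_basis W w.

(** For a fusion Riesz basis this is the image of [W i] under the inverse of the frame
    operator; as an orthogonal complement it can be handled without that inverse. *)
Definition biorthogonal (i : I) : set H :=
  [set f | forall j x, j != i -> W j x -> ip f x = 0].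

Let Ww : weighted_subspaces W w. Proof. by case: rieszW. Qed.
Let Wc i : closed_subspace (W i). Proof. by case: Ww => + _; exact. Qed.
Let w_gt0 i : 0 < w i. Proof. by case: Ww => _; exact. Qed.
Let w_neq0 i : w i != 0. Proof. exact: lt0r_neq0. Qed.

Lemma biorthogonalZ i a f : biorthogonal i f -> biorthogonal i (a *: f).
Proof. by move=> fX j x ji Wx; rewrite ipZl (fX j x ji Wx) mulr0. Qed.

Lemma riesz_total g : (forall i x, W i x -> ip g x = 0) -> g = 0.
Proof.
move=> gW; apply/eqP/negPn/negP => g0.
have gspan : linear_span (\bigcup_i W i) `<=` [set x | ip g x = 0].
  apply: smallest_sub => [|x [i _ Wx]]; last exact: gW Wx.
  split=> [|a x y /= gx gy]; first exact: linear0r.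
  by rewrite linearDr /= ipZr gx gy mulr0 addr0.
have : closure (linear_span (\bigcup_i W i)) g by case: rieszW => _ -> _.
have gp : 0 < `|g| by rewrite normr_gt0.
move=> /(_ _ (nbhsx_ballx g _ gp))[x [/gspan gx]].
rewrite -ball_normE /= -(ltr_pXn2r (n:=2)) ?nnegrE// (norm2B normE) gx.
by rewrite (ip_eq0C gx) !addr0 subr0 gtrDl (le_gtF (exprn_ge0 _ (normr_ge0 _))).
Qed.

Lemma riesz_synthesis_bound : exists2 D, 0 < D & synthesis_bound W w D.
Proof.
case: rieszW => _ _ [C [D [C0 D0 hCD]]]; exists D => // J h Wh.
by have [] := hCD J h (fun j _ => Wh j).
Qed.

Lemma closed_subspace_nonzero (W0 : set H) : closed_subspace W0 -> W0 <> [set 0] ->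
  exists2 x, W0 x & x != 0.
Proof.
move=> W0c Wn0; apply: contrapT => nx; apply: Wn0; apply/seteqP; split => x /=.
  by move=> Wx; apply/eqP/negPn/negP => x0; apply: nx; exists x.
by move=> ->; exact: closed_subspace0.
Qed.

(** The lower Riesz inequality for the index set [{i}], at a nonzero vector of
    [W i]. *)
Lemma riesz_weight_bounded_below : (forall i, W i <> [set 0]) ->
  exists2 C, 0 < C & forall i, C <= w i ^+ 2.
Proof.
move=> Wn0; case: rieszW => _ _ [C [D [C0 D0 hCD]]]; exists C => // i.
have [x Wx x0] := closed_subspace_nonzero (Wc i) (Wn0 i).
have Wi j : j \in [fset i]%fset -> W j x by rewrite inE => /eqP ->.
have := (hCD [fset i]%fset (fun=> x) Wi).1.
by rewrite !partial_sumE !big_seq_fset1 (norm2_weighted Ww) ler_pM2r ?norm2_gt0.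
Qed.

(** The lower Riesz inequality keeps a nonzero [g] in [W i] at positive distance from
    the sums [L] of the other subspaces, so the component of [g] orthogonal to [L] is
    nonzero. *)
Lemma biorthogonal_nontrivial i : W i <> [set 0] ->
  exists2 f, biorthogonal i f & f != 0.
Proof.
move=> Wn0.
have [g Wg g0] := closed_subspace_nonzero (Wc i) Wn0.
pose L : set H := [set x : H | exists h : I -> H, [/\ forall j, W j (h j), h i = 0 &
  partial_sum (fun j => w j *: h j) @ totally --> x]].
have Ll : linear_subspace L.
  split.
    exists (fun=> 0); split => //; first by move=> j; exact: closed_subspace0.
    rewrite -[0 in X in _ --> X](scaler0 _ (w i)).
    by apply: (@cvg_partial_sum1 K I H _ i) => j _; rewrite scaler0.
  move=> a x y [h [Wh hi hx]] [h' [Wh' hi' hy]].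
  exists (fun j => a *: h j + h' j); split.
  - by move=> j; case: (Wc j) => -[_ WD] _; exact: WD.
  - by rewrite hi hi' scaler0 addr0.
  - apply: cvg_trans (cvgD (cvgZ (cvg_cst a) hx) hy).
    apply: near_eq_cvg; apply: (near_totally (J0 := fset0)) => J _.
    rewrite !fctE !partial_sumE scaler_sumr -big_split /=; apply: eq_bigr => j _.
    by rewrite scalerDr !scalerA mulrC.
have [p clp hp] := projection_closure normE g Ll.
exists (g - p).
  move=> j x ji Wx; apply: hp; exists (delta_fam j ((w j)^-1 *: x)); split.
  - by apply: delta_fam_in => //; exact: closed_subspaceZ.
  - by rewrite /delta_fam eq_sym (negPf ji).
  - have := @cvg_synthesis_delta R k H I w j ((w j)^-1 *: x).
    by rewrite scalerA mulfV// scale1r.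
rewrite subr_eq0; apply/negP => /eqP gp; move: clp; rewrite -gp => clg; clear p gp hp.
case: rieszW => _ _ [C [D [C0 D0 hCD]]].
pose c := C * `|(w i)^-1 *: g| ^+ 2.
have c0 : 0 < c by rewrite mulr_gt0// norm2_gt0// scaler_eq0 invr_eq0 negb_or w_neq0.
(* Any [e > 0] with [e ^+ 2 <= c] serves as a lower bound for the distance; this
   choice avoids square roots. *)
pose e := c / (1 + c).
have c1 : 0 < 1 + c by rewrite addr_gt0.
have e0 : 0 < e by rewrite divr_gt0.
have ec : e ^+ 2 <= c.
  have e1 : e <= 1 by rewrite ler_pdivrMr// mul1r lerDr.
  apply: (@le_trans _ _ e).
    by rewrite expr2 ler_piMl// ltW.
  by rewrite ler_pdivrMr// ler_peMr ?ltW// ltrDl.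
have [x [[h [Wh hi hx]]]] := clg _ (nbhsx_ballx g _ e0).
rewrite -ball_normE /= => gx.
suff : e <= `|g - x| by move=> /(lt_le_trans gx); rewrite ltxx.
pose h' j := delta_fam i ((w i)^-1 *: g) j - h j.
have Wh' j : W j (h' j).
  apply: closed_subspaceB => //; apply: delta_fam_in => //.
  exact: closed_subspaceZ.
have cg : partial_sum (fun j => w j *: delta_fam i ((w i)^-1 *: g) j) @ totally --> g.
  have := @cvg_synthesis_delta R k H I w i ((w i)^-1 *: g).
  by rewrite scalerA mulfV// scale1r.
apply: (cvg_totally_le (J0 := [fset i]%fset) (cvg_cst e) (cvg_norm (cvgB cg hx))) => J iJ.
rewrite fctE -partial_sumB -(ler_pXn2r (n:=2)) ?nnegrE ?(ltW e0)//.
apply: (le_trans ec).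
have -> : partial_sum (fun j => w j *: delta_fam i ((w i)^-1 *: g) j - w j *: h j) J =
    partial_sum (fun j => w j *: h' j) J.
  by rewrite !partial_sumE; apply: eq_bigr => j _; rewrite -scalerBr.
apply: le_trans (hCD J h' (fun j _ => Wh' j)).1.
rewrite /c ler_pM2l//.
apply: le_trans (partial_sum_mono (J0 := [fset i]%fset) _ iJ); last first.
  by move=> j; rewrite exprn_ge0.
by rewrite partial_sumE big_seq_fset1 /h' /delta_fam eqxx hi subr0.
Qed.

Lemma synthesis_adj_biorthogonal i f : biorthogonal i f ->
  synthesis_adj ip W w f = delta_fam i (w i *: orth_proj ip (W i) f).
Proof.
move=> fX; have [D D0 hD] := riesz_synthesis_bound.
rewrite (synthesis_adjE normE Ww D0 hD); apply/funext => j; rewrite /delta_fam.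
case: eqVneq => [->//|ji]; rewrite (orth_proj_eq0 normE (Wc j)) ?scaler0// => x.
exact: fX.
Qed.

(** On [biorthogonal i] the frame operator is [w i ^+ 2 *: orth_proj ip (W i) f], so
    this value of the inverse follows from injectivity alone. *)
Lemma frame_operator_inv_biorthogonal i f : biorthogonal i f ->
  frame_operator_inv ip W w (w i *: orth_proj ip (W i) f) = (w i)^-1 *: f.
Proof.
move=> fX; have [D D0 hD] := riesz_synthesis_bound.
apply: (frame_operator_inj normE Ww D0 hD riesz_total).
have Sf : frame_operator ip W w ((w i)^-1 *: f) = w i *: orth_proj ip (W i) f.
  rewrite /frame_operator (synthesis_adj_biorthogonal (biorthogonalZ _ fX)).
  by rewrite synthesis_delta (orth_projZ normE (Wc i)) [w i *: (_^-1 *: _)]scalerA mulfV// scale1r.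
rewrite Sf /frame_operator_inv; apply: pinvK.
by apply/mem_set; exists ((w i)^-1 *: f).
Qed.

Lemma frame_operator_inv0 (i : I) : frame_operator_inv ip W w 0 = 0.
Proof.
have X0 : biorthogonal i 0 by move=> j x _ _; rewrite linear0l.
have := frame_operator_inv_biorthogonal X0.
rewrite (orth_proj_eq0 normE (Wc i)) ?scaler0// => x _.
exact: linear0l.
Qed.

Variables (V : I -> set H) (v : I -> K).
Hypothesis dualWV : fusion_dual ip W w V v.

(** At [f] the duality identity has one nonzero term on its left-hand side and reads
    [v i *: orth_proj ip (V i) ((w i)^-1 *: f) = f]. *)
Lemma dual_contains_biorthogonal i f : biorthogonal i f ->
  V i f /\ (f != 0 -> v i = w i).
Proof.
case: dualWV => -[[Vc _] _] dual fX.
have := dual f; rewrite (synthesis_adj_biorthogonal fX).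
have -> : phi_op ip W w V (delta_fam i (w i *: orth_proj ip (W i) f)) =
    delta_fam i (orth_proj ip (V i) ((w i)^-1 *: f)).
  apply/funext => j; rewrite /phi_op /delta_fam; case: eqVneq => [->|ji].
    by rewrite frame_operator_inv_biorthogonal.
  rewrite (frame_operator_inv0 i).
  by rewrite (orth_proj_eq0 normE (Vc j))// => x _; exact: linear0l.
rewrite synthesis_delta => vf.
have Vf : V i f.
  by rewrite -vf; apply: closed_subspaceZ => //; exact: orth_proj_in.
split => // f0; move: vf.
rewrite (orth_proj_id normE (Vc i)); last exact: closed_subspaceZ.
rewrite scalerA => /eqP; rewrite -subr_eq0 -{2}[f]scale1r -scalerBl scaler_eq0.
by rewrite (negPf f0) orbF subr_eq0 => /eqP/(canRL (divfK (w_neq0 i))); rewrite mul1r.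
Qed.

End Riesz.

(** * Parseval fusion frames *)

Section Parseval.
Variables (R : realType) (k : scalar_kind).
Notation K := (scalar_field R k).
Notation conj := (@scalar_conj R k).
Variables (H : completeNormedModType K) (ip : {dot H for conj}).
Hypothesis normE : forall f : H, `|f| ^+ 2 = ip f f.
Variables (I : countType) (Y : I -> set H) (c : I -> K).
Hypothesis parsevalY : parseval_fusion_frame ip Y c.

Let Yw : weighted_subspaces Y c. Proof. by case: parsevalY. Qed.
Let Yc i : closed_subspace (Y i). Proof. by case: Yw => + _; exact. Qed.
Let c_gt0 i : 0 < c i. Proof. by case: Yw => _; exact. Qed.

Lemma parseval_identity f :
  partial_sum (fun i => c i ^+ 2 * `|orth_proj ip (Y i) f| ^+ 2) @ totally --> `|f| ^+ 2.
Proof.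
case: parsevalY => _ /(_ f)[s sf]; rewrite mul1r => -[fs sf'].
by have -> : `|f| ^+ 2 = s by apply: le_anti; rewrite fs.
Qed.

Lemma parseval_bessel (J : {fset I}) f :
  partial_sum (fun i => c i ^+ 2 * `|orth_proj ip (Y i) f| ^+ 2) J <= `|f| ^+ 2.
Proof.
apply: partial_sum_le_lim; last exact: parseval_identity.
by move=> i; rewrite (weighted_term_ge0 _ Yw).
Qed.

Lemma parseval_synthesis_bound : synthesis_bound Y c 1.
Proof.
apply: (synthesis_bound_of_bessel normE Yw) => // J f.
by rewrite mul1r parseval_bessel.
Qed.

(** The partial sum [z] satisfies [ip z f = s] and [`|z| ^+ 2 <= s], where [s] is the
    partial sum of the Parseval series, so that [`|f - z| ^+ 2 <= `|f| ^+ 2 - s]. *)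
Lemma parseval_reconstruction f :
  partial_sum (fun i => c i ^+ 2 *: orth_proj ip (Y i) f) @ totally --> f.
Proof.
apply/cvgrPdist_lt => e e0.
have e2 : 0 < e ^+ 2 by rewrite exprn_gt0.
move/cvgrPdist_lt/(_ _ e2) : (@parseval_identity f); apply: filterS => J.
rewrite ger0_norm ?subr_ge0 ?parseval_bessel// => fJ.
rewrite -(ltr_pXn2r (n:=2)) ?nnegrE ?(ltW e0)//; apply: le_lt_trans fJ.
set z := partial_sum _ J; set s := partial_sum _ J.
have zf : ip z f = s by exact: ip_weighted_proj.
have s0 : 0 <= s by apply: partial_sum_ge0 => i; rewrite (weighted_term_ge0 _ Yw).
have fz : ip f z = s by rewrite ipC zf scalar_conj_ge0.
have zs : `|z| ^+ 2 <= s.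
  have Yp i : Y i (c i *: orth_proj ip (Y i) f).
    by apply: closed_subspaceZ => //; exact: orth_proj_in.
  have := parseval_synthesis_bound J Yp; rewrite mul1r.
  have <- : z = partial_sum (fun i => c i *: (c i *: orth_proj ip (Y i) f)) J.
    by rewrite /z !partial_sumE; apply: eq_bigr => i _; rewrite scalerA -expr2.
  move=> /le_trans; apply; rewrite /s !partial_sumE ler_sum// => i _.
  by rewrite (norm2_weighted Yw).
rewrite (norm2B normE) zf fz -subr_ge0.
have -> : `|f| ^+ 2 - s - (`|f| ^+ 2 + `|z| ^+ 2 - (s + s)) = s - `|z| ^+ 2 by ring.
by rewrite subr_ge0.
Qed.

Lemma parseval_weight_le1 i : Y i <> [set 0] -> c i ^+ 2 <= 1.
Proof.
move=> /(closed_subspace_nonzero (Yc i))[y Yy y0].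
have := parseval_bessel [fset i]%fset y.
by rewrite partial_sumE big_seq_fset1 (orth_proj_id normE (Yc i))// ger_pMl ?norm2_gt0.
Qed.

(** For [y] in [Y i] the [i]-th term of the Parseval series is already [`|y| ^+ 2],
    which leaves nothing for the other projections of [y]. *)
Lemma parseval_weight1_orthogonal i j y z :
  c i ^+ 2 = 1 -> j != i -> Y i y -> Y j z -> ip z y = 0.
Proof.
move=> ci ji Yy Yz; have := parseval_bessel [fset j; i]%fset y.
rewrite partial_sumE big_fsetU1 ?inE//= big_seq_fset1 ci mul1r.
rewrite (orth_proj_id normE (Yc i))// gerDr pmulr_rle0 ?exprn_gt0// => h.
apply: ip_eq0C; apply: (orth_proj_eq0_ip normE (Yc j)) Yz.
by apply/eqP; rewrite -normr_eq0 -sqrf_eq0 eq_le h exprn_ge0.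
Qed.

End Parseval.

(** * The kernel of the synthesis operator of a scaled frame *)

Lemma has_dim1_generator (K : numFieldType) (E : lmodType K) (N : set E) :
  has_dim N 1 -> exists n, [/\ N n, n != 0 & forall h, N h -> exists a : K, h = a *: n].
Proof.
move=> [b free_b ->]; exists (b ord0); split.
- by exists (fun=> 1) => //; rewrite big_ord1 scale1r.
- apply/eqP => b0; have := free_b (fun=> 1) _ ord0.
  by rewrite big_ord1 b0 scaler0 => /(_ erefl)/eqP; rewrite oner_eq0.
- by move=> h [a _ <-]; exists (a ord0); rewrite big_ord1.
Qed.

Lemma continuous_linear_bound (K : numFieldType) (H : normedModType K) (T : {linear H -> H}) :
  continuous T -> exists2 M : K, 0 < M & forall z, `|T z| <= M * `|z|.
Proof.
move=> /(_ 0)/continuous_linear_bounded/linear_boundedP[M [Mr hM]].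
exists (`|M| + 1); first by rewrite ltr_wpDl.
move=> z; apply: hM; apply: le_lt_trans (real_ler_norm Mr) _.
by rewrite ltrDl.
Qed.

Section ScaledKernel.
Variables (R : realType) (k : scalar_kind).
Notation K := (scalar_field R k).
Notation conj := (@scalar_conj R k).
Variables (H : completeNormedModType K) (ip : {dot H for conj}).
Hypothesis normE : forall f : H, `|f| ^+ 2 = ip f f.
Variables (I : countType) (V : I -> set H) (v : I -> K).
Hypothesis Vw : weighted_subspaces V v.
Variables (U U' : {linear H -> H}) (c : I -> K).
Hypotheses (U'_cont : continuous U') (UK : cancel U U').
Local Notation Y := (fun i => U @` V i).
Hypothesis parsevalY : parseval_fusion_frame ip Y c.

(** Apply [U'] to the reconstruction formula for [U x], subtract [x], and divide the
    [i]-th term by [v i].  The family obtained is square-summable since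
    [`|c i ^+ 2 - (i == j)%:R| ^+ 2] is at most a constant times [c i ^+ 2], while
    [v i ^+ 2] is bounded below and [U'] is bounded. *)
Lemma scaled_kernel_vector (C : K) (j : I) (x : H) :
    0 < C -> (forall i, C <= v i ^+ 2) -> (forall i, V i <> [set 0]) -> V j x ->
  synthesis_kernel V v
    (fun i => ((c i ^+ 2 - (i == j)%:R) / v i) *: U' (orth_proj ip (Y i) (U x))).
Proof.
move=> C0 vC Vn0 Vx; have [Vc v0] := Vw; have [[Yc c0] _] := parsevalY.
have [M M0 hM] := continuous_linear_bound U'_cont.
have Yx : Y j (U x) by exists x.
have Yn0 i : Y i <> [set 0].
  move=> Y0; apply: (Vn0 i); apply/seteqP; split => y /=; last first.
    by move=> ->; exact: closed_subspace0.
  move=> Vy; have : Y i (U y) by exists y.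
  by rewrite Y0 /= => /(congr1 U'); rewrite UK linear0.
have Vp i : V i (U' (orth_proj ip (Y i) (U x))).
  by have [y Vy <-] := orth_proj_in normE (Yc i) (U x); rewrite UK.
split; last first.
  apply: lim_partial_sum.
  have c1 := cvg_comp _ _ (@parseval_reconstruction _ _ _ _ normE _ _ _ parsevalY (U x))
    (@U'_cont (U x)).
  have c2 := @cvg_synthesis_delta R k H I (fun=> 1) j x.
  have := cvgB c1 c2; rewrite UK scale1r subrr => c3.
  apply: cvg_trans (c3 (totally_filter (I := I))); apply: near_eq_cvg.
  apply: (near_totally (J0 := fset0)) => J _.
  rewrite fctE /= -(partial_sum_linear U') -partial_sumB !partial_sumE; apply: eq_bigr => i _.
  rewrite scalerA mulrC divfK ?lt0r_neq0// scalerBl linearZ; congr (_ - _).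
  rewrite scale1r /delta_fam; case: eqVneq => [->|_]; last by rewrite scale0r.
  by rewrite (orth_proj_id normE (Yc j))// UK scale1r.
split; first by move=> i; exact: closed_subspaceZ.
(* The summand [1] covers the indices [i != j], where [c i ^+ 4 <= c i ^+ 2]; the
   other one covers [i = j]. *)
pose kappa := 1 + (c j ^+ 2)^-1.
apply: (@cvg_partial_sum_bounded R k I _ ((kappa / C * M ^+ 2) * `|U x| ^+ 2)).
  by move=> i; rewrite exprn_ge0.
have kappa0 : 0 < kappa by rewrite addr_gt0// invr_gt0 exprn_gt0.
move=> J; have kCM : 0 < kappa / C * M ^+ 2 by rewrite mulr_gt0 ?divr_gt0 ?exprn_gt0.
apply: (@le_trans _ _ (kappa / C * M ^+ 2 *
   partial_sum (fun i => c i ^+ 2 * `|orth_proj ip (Y i) (U x)| ^+ 2) J)); last first.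
  by rewrite ler_pM2l// (parseval_bessel parsevalY).
rewrite !partial_sumE mulr_sumr; apply: ler_sum => i _.
rewrite normrZ exprMn [leRHS]mulrACA; apply: ler_pM; rewrite ?exprn_ge0//; last first.
  by rewrite -exprMn ler_pXn2r ?nnegrE ?mulr_ge0 ?(ltW M0).
rewrite normrM normfV exprMn exprVn (gtr0_norm (v0 i)) [leRHS]mulrAC.
apply: ler_pM; rewrite ?exprn_ge0 ?invr_ge0 ?exprn_ge0 ?(ltW (v0 i))//; last first.
  by rewrite lef_pV2 ?posrE ?exprn_gt0.
have ci1 : c i ^+ 2 <= 1 by exact: (parseval_weight_le1 normE parsevalY (Yn0 i)).
rewrite real_normK; last first.
  apply: rpredB; first by apply: ger0_real; rewrite exprn_ge0 ?ltW.
  by case: (i == j); rewrite ?rpred0 ?rpred1.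
case: eqVneq => [ij|_]; last first.
  rewrite subr0 expr2 ler_wpM2r ?exprn_ge0 ?(ltW (c0 i))//.
  by apply: le_trans ci1 _; rewrite lerDl invr_ge0 exprn_ge0 ?ltW.
rewrite /kappa -ij mulrDl mul1r mulVf ?lt0r_neq0 ?exprn_gt0//.
rewrite -sqrrN opprB expr2; apply: (@le_trans _ _ 1).
  rewrite -[leRHS]mulr1; apply: ler_pM; rewrite ?subr_ge0// gerBl exprn_ge0// ltW//.
by rewrite lerDr exprn_ge0// ltW.
Qed.

(** The subspace [Y j] is orthogonal to the others, so it cannot take part in a
    relation [\sum_i v i *: U (n i) = 0]. *)
Lemma scaled_kernel_weight1 (n : I -> H) (j : I) :
    continuous U -> (forall i, V i (n i)) ->
    partial_sum (fun i => v i *: n i) @ totally --> (0 : H) ->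
  c j ^+ 2 = 1 -> n j = 0.
Proof.
move=> U_cont Vn n0 cj; have [_ v0] := Vw.
have := cvg_comp _ _ n0 (@U_cont 0); rewrite linear0 => Un0.
have Un1 : partial_sum (fun i => v i *: U (n i)) @ totally --> (0 : H).
  apply: cvg_trans Un0; apply: near_eq_cvg; apply: (near_totally (J0 := fset0)) => J _ /=.
  rewrite -(partial_sum_linear U) !partial_sumE.
  by apply: eq_bigr => i _; rewrite linearZ.
have := cvg_ip_sum normE (g := U (n j)) Un1; rewrite linear0l => l0.
have l1 : partial_sum (fun i => ip (v i *: U (n i)) (U (n j))) @ totally -->
    ip (v j *: U (n j)) (U (n j)).
  apply: (@cvg_partial_sum1 K I K (fun i => ip (v i *: U (n i)) (U (n j)))) => i ij.
  rewrite ipZl (parseval_weight1_orthogonal normE parsevalY cj ij) ?mulr0//.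
    by exists (n j).
  by exists (n i).
have : ip (v j *: U (n j)) (U (n j)) = 0 by exact: norm_cvg_unique l1 l0.
move=> /eqP; rewrite ipZl mulf_eq0 (negPf (lt0r_neq0 (v0 j))) /= -normE sqrf_eq0 normr_eq0.
by move=> /eqP/(congr1 U'); rewrite UK linear0.
Qed.

(** If [c j ^+ 2 != 1], the [j]-th entry of the vector of [scaled_kernel_vector] is a
    nonzero multiple of [x] and, the kernel being a line, a multiple of [n j]. *)
Lemma scaled_kernel_component (C : K) (n : I -> H) (j : I) (x : H) :
    0 < C -> (forall i, C <= v i ^+ 2) -> (forall i, V i <> [set 0]) ->
    continuous U -> (forall i, V i (n i)) ->
    partial_sum (fun i => v i *: n i) @ totally --> (0 : H) ->
    (forall h, synthesis_kernel V v h -> exists a : K, h = a *: n) ->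
    V j x -> x != 0 ->
  exists b, n j = b *: x.
Proof.
move=> C0 vC Vn0 U_cont Vn n0 ngen Vx x0.
have [cj|cj] := eqVneq (c j ^+ 2) 1.
  by exists 0; rewrite scale0r; exact: scaled_kernel_weight1.
have [a ha] := ngen _ (scaled_kernel_vector C0 vC Vn0 Vx).
have [[Yc _] _] := parsevalY; have [_ v0] := Vw.
have := congr1 (fun h => h j) ha; rewrite /= eqxx (orth_proj_id normE (Yc j)); last by exists x.
rewrite UK fctE; set t := _ / _ => tx.
have t0 : t != 0 by rewrite mulf_neq0 ?subr_eq0// invr_eq0 lt0r_neq0.
have a0 : a != 0.
  apply/eqP => a0; move: tx; rewrite a0 scale0r => /eqP.
  by rewrite scaler_eq0 (negPf t0) (negPf x0).
by exists (a^-1 * t); rewrite -scalerA tx scalerA mulVf// scale1r.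
Qed.

End ScaledKernel.

(** Pairing the relation with an element of [W j] isolates its [j]-th term; hence
    [n j] is orthogonal to [W j] too, and thus to all the subspaces. *)
Lemma biorthogonal_independent (R : realType) (k : scalar_kind)
    (H : completeNormedModType (scalar_field R k))
    (ip : {dot H for @scalar_conj R k})
    (normE : forall f : H, `|f| ^+ 2 = ip f f)
    (I : countType) (W : I -> set H) (w v : I -> scalar_field R k) (n : I -> H) :
    fusion_riesz_basis W w -> (forall i, v i != 0) ->
    (forall i, biorthogonal ip W i (n i)) ->
    partial_sum (fun i => v i *: n i) @ totally --> (0 : H) ->
  forall i, n i = 0.
Proof.
move=> rieszW v0 nX n0 i; apply: (riesz_total normE rieszW) => j x Wx.
have [ji|ji] := eqVneq j i; last exact: nX ji Wx.
subst i.
have := cvg_ip_sum normE (g := x) n0; rewrite linear0l => l0.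
have l1 : partial_sum (fun i => ip (v i *: n i) x) @ totally --> ip (v j *: n j) x.
  apply: (@cvg_partial_sum1 _ I (scalar_field R k) (fun i => ip (v i *: n i) x)) => i ij.
  by rewrite ipZl (nX i j x) ?mulr0// eq_sym.
have : ip (v j *: n j) x = 0 by exact: norm_cvg_unique l1 l0.
by move=> /eqP; rewrite ipZl mulf_eq0 (negPf (v0 j)) /= => /eqP.
Qed.

(* The statement fails if some W_i may be the zero subspace, hence [W_neq0]. *)
Theorem corollary2p10 (R : realType) (k : scalar_kind)
    (H : completeNormedModType (scalar_field R k))
    (ip : {dot H for @scalar_conj R k})
    (normE : forall f : H, `|f| ^+ 2 = ip f f)
    (sepH : separable_space H)
    (I : countType) (W V : I -> set H) (w v : I -> scalar_field R k)
    (W_neq0 : forall i, W i <> [set 0])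
    (rieszW : fusion_riesz_basis W w)
    (frameV : fusion_frame ip V v)
    (dualWV : fusion_dual ip W w V v)
    (excessV : has_excess V v 1) :
  ~ operator_scalable ip V v.
Proof.
move=> [U [gamma [[U_cont [U' [U'_cont UK _]]] _ parsevalY]]].
have [Vw [B B0 hB]] := dualWV.1.
have [Vc v0] := Vw.
have [n [[[Vn n_l2] n_ker] n_neq0 n_gen]] := has_dim1_generator excessV.
have VB : synthesis_bound V v B.
  apply: (synthesis_bound_of_bessel normE Vw B0) => J f.
  have [s sf sB] := hB f; apply: le_trans sB; apply: partial_sum_le_lim sf.
  by move=> i; rewrite (weighted_term_ge0 _ Vw).
have n0 : partial_sum (fun i => v i *: n i) @ totally --> (0 : H).
  by rewrite -n_ker; exact: (cvg_synthesis B0 VB).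
have xX i : exists x, [/\ biorthogonal ip W i x, V i x, x != 0 & v i = w i].
  have [x Xx x0] := biorthogonal_nontrivial normE rieszW (W_neq0 i).
  have [Vx vw] := dual_contains_biorthogonal normE rieszW dualWV Xx.
  by exists x; split => //; exact: vw.
have [C C0 wC] := riesz_weight_bounded_below rieszW W_neq0.
have vC i : C <= v i ^+ 2 by have [x [_ _ _ ->]] := xX i.
have Vn0 i : V i <> [set 0].
  by have [x [_ Vx /eqP x0 _]] := xX i => V0; apply: x0; move: Vx; rewrite V0.
have nX i : biorthogonal ip W i (n i).
  have [x [Xx Vx x0 _]] := xX i.
  have [b ->] := scaled_kernel_component normE Vw U'_cont UK parsevalY C0 vC Vn0
    U_cont Vn n0 n_gen Vx x0.
  exact: biorthogonalZ.
move/eqP: n_neq0; apply; apply/funext => i.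
by apply: (biorthogonal_independent normE rieszW _ nX n0) => j; exact: lt0r_neq0.
Qed.
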